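(* For any complete graph $K_n$ with $n\geq 3$, $\mathrm{fgndi}_{\sum}(K_n)=3$.
   Context: For a finite simple graph $G$ and an integer $k\ge 1$, a non-proper total $k$-coloring is an arbitrary map $f: V(G)\cup E(G)\rightarrow \{1,2,\dots,k\}$. Its weight function is $$\phi(x)=f(x)+\sum_{e\ni x}f(e)+\sum_{y\in N(x)}f(y)\quad (x\in V(G)),$$ where the first sum is over the edges $e$ incident with $x$ and $N(x)=\{y\in V(G): xy\in E(G)\}$. The coloring $f$ is called a neighbor full sum distinguishing (NFSD) total $k$-coloring if $\phi(x)\neq\phi(y)$ for every edge $xy\in E(G)$. The neighbor full sum distinguishing total chromatic number $\mathrm{fgndi}_{\sum}(G)$ is the smallest $k$ for which $G$ has an NFSD total $k$-coloring. *)

(* Defs.v *)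
From HB Require Import structures.
From mathcomp Require Import all_boot.

Set Implicit Arguments.
Unset Strict Implicit.
Unset Printing Implicit Defensive.

Record sgraph := SGraph {
  vertex :> finType;
  adj : rel vertex;
  adj_sym : symmetric adj;
  adj_irrefl : irreflexive adj }.

Definition edge_set (G : sgraph) : {set {set G}} :=
  [set [set p.1; p.2] | p : G * G & adj p.1 p.2].

Definition edge (G : sgraph) : finType := {E : {set G} | E \in edge_set G}.

(* The domain V(G) + E(G) is a disjoint sum; a color is a natural number in
   {1, ..., k}, so that it can be added directly. *)
Definition total_coloring (G : sgraph) (k : nat) (f : G + edge G -> nat) : Prop :=
  forall z, 1 <= f z <= k.

Definition full_sum (G : sgraph) (f : G + edge G -> nat) (x : G) : nat :=
  f (inl x) + \sum_(E : edge G | x \in val E) f (inr E)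
    + \sum_(y : G | adj x y) f (inl y).

Definition NFSD_coloring (G : sgraph) (k : nat) (f : G + edge G -> nat) : Prop :=
  total_coloring k f /\
  forall x y : G, adj x y -> full_sum f x <> full_sum f y.

Definition NFSD_colorable (G : sgraph) (k : nat) : Prop :=
  exists f : G + edge G -> nat, NFSD_coloring k f.

(* The NFSD chromatic number of G equals k.  It is a relation because some
   graphs (K_2, for instance) have no NFSD total coloring at all. *)
Definition fgndi_is (G : sgraph) (k : nat) : Prop :=
  [/\ 1 <= k, NFSD_colorable G k
    & forall j : nat, 1 <= j -> NFSD_colorable G j -> k <= j].

Lemma neq_sym (T : eqType) : symmetric (fun x y : T => x != y).
Proof. by move=> x y; rewrite eq_sym. Qed.

Lemma neq_irrefl (T : eqType) : irreflexive (fun x y : T => x != y).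
Proof. by move=> x; rewrite eqxx. Qed.

Definition complete_graph (n : nat) : sgraph :=
  SGraph (@neq_sym 'I_n) (@neq_irrefl 'I_n).

(* Main.v *)
Require Import Defs.
From Stdlib Require Import Lia.
From HB Require Import structures.
From mathcomp Require Import all_boot.

(** In a complete graph the closed neighbourhood of every vertex is the whole
    vertex set, so the vertex colors contribute the same constant to every full
    sum ([full_sum_complete]).  Hence a coloring is NFSD exactly when its edge
    colors give pairwise distinct sums at the vertices.

    Two colors are not enough: the sum at a vertex is then determined by its
    degree in the graph of the edges colored 2, and a finite graph with at least
    two vertices always has two vertices of equal degree ([equal_degrees]).

    Three colors suffice: give the edge [{i, j}] the color
    [1 + (n <= i + j) + (b <= i + j)] with [b] the largest even number below
    [n].  The threshold [n] alone contributes [i] to the sum at the vertex [i],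
    less 1 as soon as [2i >= n] because [j = i] is excluded
    ([threshold_degree]): it increases by 1 from each vertex to the next, except
    at the step where that loss sets in.  The threshold [b] behaves in the same
    way (up to a boundary effect at the last vertex), but its loss sets in one
    step earlier, at [i = b/2].  The two losses never occur at the same step, so
    the sums are strictly increasing. *)

Set Implicit Arguments.
Unset Strict Implicit.
Unset Printing Implicit Defensive.

Section EdgeSums.
Variable G : sgraph.

(** The value is [0] off the edges, so that edge colors can be handled as a
    function of two vertices. *)
Definition pair_color (c : edge G -> nat) (x y : G) : nat :=
  oapp c 0 (insub [set x; y]).

Lemma pair_colorC c x y : pair_color c x y = pair_color c y x.
Proof. by rewrite /pair_color setUC. Qed.

Lemma pair_color_adj c x y : adj x y ->
  exists2 E : edge G, val E = [set x; y] & pair_color c x y = c E.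
Proof.
move=> xy; have xyE : [set x; y] \in edge_set G.
  by apply/imsetP; exists (x, y); rewrite ?inE.
by exists (Sub [set x; y] xyE); rewrite ?SubK // /pair_color insubT.
Qed.

(** The map [y |-> {x, y}] is a bijection from the neighbors of [x] to the edges
    at [x]. *)
Lemma sum_incident (c : edge G -> nat) (x : G) :
  \sum_(E : edge G | x \in val E) c E = \sum_(y | adj x y) pair_color c x y.
Proof.
have adj_neq y : adj x y -> x != y.
  by move=> xy; apply: contraTneq xy => ->; rewrite adj_irrefl.
pose other (E : edge G) : G := odflt x [pick y in val E | y != x].
have otherE (E : edge G) y : val E = [set x; y] -> x != y -> other E = y.
  move=> eqE neq; rewrite /other; case: pickP => [z|/(_ y)] /=; rewrite eqE !inE.
    by case/andP=> /orP[] /eqP-> //; rewrite eqxx.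
  by rewrite eqxx orbT eq_sym neq.
have edgeE (E : edge G) : x \in val E -> exists2 y, adj x y & val E = [set x; y].
  have /imsetP[[a b]] := valP E; rewrite inE /= => ab -> .
  rewrite !inE => /orP[] /eqP eqx; subst x; first by exists b.
  by exists a; rewrite 1?adj_sym 1?setUC.
rewrite (partition_big other (fun y => adj x y)) /=; last first.
  by move=> E /edgeE[y xy /otherE->] //; apply: adj_neq.
apply: eq_bigr => y xy; have [E0 E0E ->] := pair_color_adj c xy.
rewrite (big_pred1 E0) // => E; apply/andP/eqP => [[xE /eqP oE]|->].
  have [z xz zE] := edgeE E xE; apply/val_inj.
  by rewrite E0E zE -oE (otherE E z) ?adj_neq.
by rewrite E0E !inE eqxx (otherE E0 y) ?adj_neq.
Qed.

(** If the degrees were pairwise distinct, they would take all the values less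
    than [#|G|]; but a vertex of degree 0 and a vertex adjacent to all others
    cannot coexist. *)
Lemma equal_degrees : 1 < #|G| ->
  exists x y : G, x != y /\ #|adj x| = #|adj y|.
Proof.
move=> G_gt1; have G_gt0 : 0 < #|G| by apply: ltnW.
pose deg (x : G) := #|adj x|.
have deg_lt x : deg x < #|G|.
  apply/proper_card/properP; split; first exact/subsetP.
  by exists x; rewrite // -topredE /= adj_irrefl.
pose d x : 'I_#|G| := Ordinal (deg_lt x).
have [/injectiveP d_inj|/injectivePn[x [y neq /(congr1 val) /= eqd]]] :=
  boolP (injectiveb d); last by exists x, y.
have d_onto (k : 'I_#|G|) : exists x, deg x = k.
  have /codomP[x ->] : k \in codom d by rewrite inj_card_onto ?card_ord.
  by exists x.
have [x /card0_eq x0] := d_onto (Ordinal G_gt0).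
have pred_lt : #|G|.-1 < #|G| by rewrite prednK.
have [y /= degy] := d_onto (Ordinal pred_lt).
have neq : x != y.
  apply: contraTneq G_gt1 => eqxy; subst y.
  by rewrite -(prednK G_gt0) -degy /deg (eq_card0 x0).
(* Neither [x] nor [y] is a neighbor of [y]. *)
have : deg y <= #|~: [set x; y]|.
  apply/subset_leq_card/subsetP => z; rewrite -topredE !inE /= => yz.
  apply/norP; split; apply: contraTneq yz => ->; rewrite ?adj_irrefl //.
  by rewrite adj_sym; have := x0 y; rewrite -topredE /= => ->.
by rewrite degy -(cardsC [set x; y]) cards2 neq addSn [_.-1]/= add1n ltnn.
Qed.

End EdgeSums.

Lemma full_sum_complete n (f : complete_graph n + edge (complete_graph n) -> nat)
    (x : 'I_n) :
  full_sum f x = \sum_(y : 'I_n) f (inl y)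
    + \sum_(y | x != y) pair_color (fun E => f (inr E)) x y.
Proof.
rewrite /full_sum sum_incident /= [in RHS](bigD1 x) //= addnAC.
by congr (_ + _ + _); apply: eq_bigl => y; rewrite eq_sym.
Qed.

(** All edge colors are 1 or 2, so two vertices of equal degree in the graph of
    the edges colored 2 have equal full sums. *)
Lemma complete_not_2_colorable n k : 1 < n -> k <= 2 ->
  ~ NFSD_colorable (complete_graph n) k.
Proof.
move=> n_gt1 k_le2 [f [f_col f_dist]].
pose w : 'I_n -> 'I_n -> nat := pair_color (fun E => f (inr E)).
have w12 x y : x != y -> w x y = 1 + (w x y == 2).
  move=> xy.
  have [E _] :=
    @pair_color_adj (complete_graph n) (fun E => f (inr E)) x y xy.
  rewrite -/(w x y) => ->; have /andP[] := f_col (inr E).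
  by move=> + /leq_trans/(_ k_le2); case: (f (inr E)) => [|[|[|]]].
pose heavy (x y : 'I_n) := (x != y) && (w x y == 2).
have heavy_sym : symmetric heavy.
  by move=> x y; rewrite /heavy eq_sym /w pair_colorC.
have heavy_irrefl : irreflexive heavy by move=> x; rewrite /heavy eqxx.
have [|x [y [xy eqdeg]]] := @equal_degrees (SGraph heavy_sym heavy_irrefl).
  by rewrite card_ord.
have sumE z : \sum_(t | z != t) w z t = n.-1 + #|heavy z|.
  rewrite (eq_bigr (fun t => 1 + (w z t == 2))) => [|t /w12 //].
  rewrite big_split /= -big_mkcondr /= -sum1_card; congr (_ + _).
  rewrite sum1_card -[n in RHS]card_ord -(cardC1 z).
  by apply: eq_card => t; rewrite !inE eq_sym.
apply: (f_dist x y xy); rewrite !full_sum_complete; congr (_ + _).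
by rewrite -/w !sumE; congr (_ + _).
Qed.

(** The number of [j < n] with [a <= i + j] is [n - (a - i)], both subtractions
    being truncated; the last term removes [j = i]. *)
Lemma threshold_degree n a (i : 'I_n) :
  \sum_(j < n | i != j) (a <= i + j) = n - (a - i) - (a <= i + i).
Proof.
have all_j m : \sum_(j < m) (a <= i + j) = m - (a - i).
  elim: m => [|m IH]; rewrite ?big_ord0 // big_ord_recr /= IH -leq_subLR.
  case: leqP => [le_am|lt_ma]; first by rewrite subSn // addn1.
  by move: (lt_ma) (ltnW lt_ma); rewrite -!subn_eq0 => /eqP-> /eqP->.
rewrite -all_j [in RHS](bigD1 i) //= addKn.
by apply: eq_bigl => j; rewrite eq_sym.
Qed.

(** The loss of the threshold [n] sets in at [n/2] rounded up, that of [b] at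
    [b/2], one less.  For even [n] the threshold [b = n - 2] gains nothing at the
    last step, as [b - i] is already truncated to 0; no loss sets in there since
    [n > 2]. *)
Lemma threshold_sum_incr n x y (b := n.-1./2.*2) : 2 < n -> x < y -> y < n ->
  (x - (n <= x + x)) + (n - (b - x) - (b <= x + x))
  < (y - (n <= y + y)) + (n - (b - y) - (b <= y + y)).
Proof.
move=> n_gt2 xy yn; have := odd_double_half n.-1; rewrite -/b.
have : b = n.-1./2 + n.-1./2 by rewrite addnn.
move: b n.-1./2 => b h ->; move: n_gt2 xy yn.
case: (leqP n (x + x)); case: (leqP n (y + y)); case: (leqP (h + h) (x + x));
  case: (leqP (h + h) (y + y)); case: (odd _); rewrite /= -?plusE -?minusE;
  move=> /leP ? /leP ? /leP ? /leP ? /leP ? /leP ? /leP ? ?; apply/ltP; lia.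
Qed.

Lemma complete_3_colorable n : 2 < n -> NFSD_colorable (complete_graph n) 3.
Proof.
move=> n_gt2; pose b := n.-1./2.*2.
pose color s := 1 + (n <= s) + (b <= s).
(* The sum of the members of the set [{i, j}] is [i + j]. *)
pose f (z : complete_graph n + edge (complete_graph n)) :=
  if z is inr E then color (\sum_(v in val E) (v : 'I_n)) else 1.
exists f; split.
  by case=> [v|E] //=; rewrite /color; case: (n <= _); case: (b <= _).
have sumE (x : 'I_n) : \sum_(y | x != y) pair_color (fun E => f (inr E)) x y
    = n.-1 + (x - (n <= x + x)) + (n - (b - x) - (b <= x + x)).
  rewrite -[x in x - _](subKn (ltnW (ltn_ord x))).
  rewrite -!threshold_degree -[X in X.-1](card_ord n) -(cardC1 x) -sum1_card.
  rewrite [X in X + _ + _](eq_bigl (fun y => x != y)) => [|y]; last first.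
    by rewrite !inE eq_sym.
  rewrite -!big_split /=; apply: eq_bigr => y xy.
  have [E Exy ->] :=
    @pair_color_adj (complete_graph n) (fun E => f (inr E)) x y xy.
  by rewrite /= Exy big_setU1 ?inE //= big_set1.
have incr (x y : 'I_n) : x < y -> full_sum f x < full_sum f y.
  move=> xy; rewrite !full_sum_complete ltn_add2l !sumE -!addnA ltn_add2l.
  exact: threshold_sum_incr.
move=> x y xy eqxy; have : (x : nat) != y by [].
by rewrite neq_ltn => /orP[] /incr; rewrite eqxy ltnn.
Qed.

Theorem theorem10 (n : nat) (hn : 3 <= n) : fgndi_is (complete_graph n) 3.
Proof.
split=> //; first exact: complete_3_colorable.
move=> j _ colj; rewrite leqNgt; apply/negP => j_lt3.
exact: (@complete_not_2_colorable n j (ltnW hn) j_lt3 colj).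
Qed.
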